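(* Let $n=p_1^{\alpha_1}\cdots p_k^{\alpha_k}$, where $k\geq 1$, $\alpha_i\geq 1$ and the $p_i$ are distinct primes satisfying $p_i\equiv 1\pmod 4$ for all $i=1,\ldots,k$. Then the number $\mathcal{K}_3(G_n)$ of cliques of order three in the Paley-type graph $G_n$ is $$\mathcal{K}_3(G_n)=\frac{1}{3\times 2^{3k+1}}\prod_{i=1}^{k}\left[p_i^{3\alpha_i-2}(p_i-1)(p_i-5)\right].$$
   Context: For $n=p_1^{\alpha_1}\cdots p_k^{\alpha_k}$ with distinct primes $p_i\equiv 1\pmod 4$ and $\alpha_i\ge 1$, let $\mathbb{Z}_n^\ast$ be the group of units of the ring $\mathbb{Z}_n=\mathbb{Z}/n\mathbb{Z}$. The Paley-type graph $G_n$ is the simple undirected graph with vertex set $\mathbb{Z}_n$ in which $xy$ is an edge if and only if $x-y\equiv a^2\pmod n$ for some $a\in\mathbb{Z}_n^\ast$ (this is symmetric since $-1$ is a square in $\mathbb{Z}_n^\ast$). For a graph $G$, $\mathcal{K}_m(G)$ denotes the number of cliques of order $m$ in $G$, i.e. the number of $m$-element sets of pairwise adjacent vertices. *)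

(* Defs.v *)
From mathcomp Require Import all_boot all_order all_algebra.
Set Implicit Arguments.
Unset Strict Implicit.
Unset Printing Implicit Defensive.
Import GRing.Theory.
Local Open Scope ring_scope.

(* A simple graph on a finite vertex type is given by its adjacency relation. *)

Definition clique (T : finType) (e : rel T) (S : {set T}) : bool :=
  [forall x in S, forall y in S, (x != y) ==> e x y].

Definition num_cliques (m : nat) (T : finType) (e : rel T) : nat :=
  #|[set S : {set T} | (#|S| == m) && clique e S]|.

(* 'Z_n is Z/nZ only for n > 1.  Under that condition the relation is
   irreflexive, 0 not being a unit; it is symmetric when -1 is the square of a
   unit, in particular when all prime factors of n are 1 mod 4. *)
Definition paley_graph (n : nat) : rel 'Z_n :=
  fun x y => [exists a : 'Z_n, (a \is a GRing.unit) && (x - y == a ^+ 2)].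

(* Main.v *)
Require Import Defs.
From mathcomp Require Import all_boot all_order all_algebra.
From mathcomp Require Import finfield ring zify.
Set Implicit Arguments.
Unset Strict Implicit.
Unset Printing Implicit Defensive.
Import GRing.Theory Num.Theory.

(** A triangle is a translate of the configuration [{0, v, u + v}], so the
number of ordered triangles is [n] times the number [M n] ([square_pairs n]
below) of pairs [(u, v)] for
which [u], [v] and [u + v] are all squares of units.  By the Chinese remainder
theorem [M] is multiplicative, and by Hensel's lemma
[M (p ^ e.+1) = p ^ (2 * e) * M p].  Finally [8 * M p] counts the solutions of
[a ^ 2 + b ^ 2 = c ^ 2] in nonzero elements of the prime field.  They are
parametrised by [b != 0] and [r = (c - a) / b]; as [r^-1 = (c + a) / b], the
excluded values of [r] are [0], the roots [1, -1] of [r ^ 2 = 1] (where [a = 0])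
and the two roots of [r ^ 2 = -1] (where [c = 0]). *)

(** * Squares of units modulo [n]: Chinese remainders and Hensel lifting *)

(** Phrased on natural numbers, so that the modulus can be factored without transport between the
    types ['Z_n]. *)
Definition unit_square (n x : nat) : bool :=
  coprime n x && [exists a : 'I_n, a ^ 2 == x %[mod n]].

Definition square_pairs (n : nat) : nat :=
  \sum_(u < n) \sum_(v < n)
    [&& unit_square n u, unit_square n v & unit_square n (u + v)].

Lemma unit_squareP n x : 0 < n ->
  reflect (coprime n x /\ exists a, a ^ 2 = x %[mod n]) (unit_square n x).
Proof.
move=> n0; apply: (iffP andP) => -[co].
  by case/existsP=> a /eqP ax; split=> //; exists a.
case=> a ax; split=> //; apply/existsP; exists (Ordinal (ltn_pmod a n0)).
by rewrite /= modnXm ax.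
Qed.

Lemma unit_square_mod n x : unit_square n (x %% n) = unit_square n x.
Proof.
rewrite /unit_square coprime_modr; congr (_ && _).
by apply: eq_existsb => a; rewrite modn_mod.
Qed.

Lemma unit_square_modD n x y :
  unit_square n (x %% n + y %% n) = unit_square n (x + y).
Proof. by rewrite -unit_square_mod modnDm unit_square_mod. Qed.

Lemma unit_squareM m n x : 0 < m -> 0 < n -> coprime m n ->
  unit_square (m * n) x = unit_square m x && unit_square n x.
Proof.
move=> m0 n0 co; apply/unit_squareP/andP; first by rewrite muln_gt0 m0.
  case=> cox [a /eqP]; rewrite chinese_remainder // => /andP[/eqP am /eqP an].
  move: cox; rewrite coprimeMl => /andP[? ?].
  by split; apply/unit_squareP => //; split=> //; exists a.
case=> /unit_squareP-/(_ m0)[com [a am]] /unit_squareP-/(_ n0)[con [b bn]].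
split; first by rewrite coprimeMl com.
exists (chinese m n a b); apply/eqP; rewrite chinese_remainder //.
rewrite -modnXm chinese_modl // modnXm am.
by rewrite -(modnXm _ n) chinese_modr // modnXm bn !eqxx.
Qed.

(* Hensel lifting: a square root [a] of [x] modulo [q = p ^ e.+1] is corrected
   to [a + t * q] where [2 * a * t] is congruent to [(x - a ^ 2) / q] mod [p]. *)
Lemma unit_square_pfactor p e x : prime p -> odd p ->
  unit_square (p ^ e.+1) x = unit_square p x.
Proof.
move=> pp op; have p0 := prime_gt0 pp.
elim: e => [|e <-]; first by rewrite expn1.
set q := p ^ e.+1; have q0 : 0 < q by rewrite expn_gt0 p0.
have pq : p %| q by rewrite /q expnS dvdn_mulr.
rewrite expnS -/q; have pq0 : 0 < p * q by rewrite muln_gt0 p0.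
apply/unit_squareP/unit_squareP => //; rewrite coprimeMl.
  case=> /andP[_ ->] [a ax]; split=> //; exists a.
  by have := congr1 (modn^~ q) ax; rewrite !modn_dvdm ?dvdn_mull.
case=> cox [a ax]; have coxp : coprime p x by apply: coprime_dvdl pq cox.
split; first by rewrite coxp.
(* [y] represents the same residue, but [y - a ^ 2] does not truncate. *)
pose y := x + p * q * a ^ 2.
have le_ay : a ^ 2 <= y.
  rewrite /y -{1}[a ^ 2]mul1n; apply: leq_trans (leq_addl _ _).
  by rewrite leq_mul2r pq0 orbT.
have yE : y = p * a ^ 2 * q + x by rewrite addnC mulnAC.
have dvd_q : q %| y - a ^ 2 by rewrite -eqn_mod_dvd // ax yE modnMDl.
have co2a : coprime p (2 * a).
  rewrite coprimeMr coprimen2 op /= -(coprime_pexpr _ _ (isT : 0 < 2)).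
  by rewrite -coprime_modr -(modn_dvdm _ pq) ax modn_dvdm // coprime_modr.
(* Chinese remaindering replaces an inverse of [2 * a] modulo [p]: [r] is [c] modulo [p] and a
   multiple of [2 * a], and the quotient is [t]. *)
pose c := (y - a ^ 2) %/ q; pose r := chinese p (2 * a) c 0.
have /dvdnP[t tE] : 2 * a %| r by rewrite /dvdn /r chinese_modr // mod0n.
have /eqP rc : r = c %[mod p] by apply: chinese_modl.
exists (a + t * q).
have -> : (a + t * q) ^ 2 = a ^ 2 + r * q + t ^ 2 * q * q.
  by rewrite tE -!mulnn; ring.
have : r * q == c * q %[mod p * q] by rewrite -!muln_modl eqn_pmul2r.
move/eqP=> rcq.
(* The quadratic term vanishes modulo [p * q] because [p] divides [q]. *)
have /dvdnP[d ->] : p * q %| t ^ 2 * q * q by rewrite dvdn_mul // dvdn_mull.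
rewrite addnC modnMDl -modnDmr rcq modnDmr /c divnK // subnKC //.
by rewrite /y -modnDmr modnMr addn0.
Qed.

(** * Multiplicativity of the pair count *)

Lemma sum_ord_modn (d p : nat) (F : nat -> nat) :
  \sum_(i < d * p) F (i %% p) = d * \sum_(i < p) F i.
Proof.
elim: d => [|d IHd]; first by rewrite big_ord0.
rewrite mulSn big_split_ord /= mulSn; congr (_ + _).
  by apply: eq_bigr => i _; rewrite modn_small.
by rewrite -IHd; apply: eq_bigr => i _; rewrite modnDl.
Qed.

Lemma sum_ord_chinese (m n : nat) (F : nat -> nat -> nat) :
  0 < m -> 0 < n -> coprime m n ->
  \sum_(i < m * n) F (i %% m) (i %% n) = \sum_(i < m) \sum_(j < n) F i j.
Proof.
move=> m0 n0 co; rewrite pair_big /=.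
pose f (i : 'I_(m * n)) := (Ordinal (ltn_pmod i m0), Ordinal (ltn_pmod i n0)).
have bij_f : bijective f.
  apply: inj_card_bij; last by rewrite card_prod !card_ord.
  move=> i j [/eqP im /eqP jn]; apply/val_inj/eqP.
  have: i == j %[mod m * n] by rewrite chinese_remainder // im.
  by rewrite !modn_small.
by rewrite (reindex f) //; apply: onW_bij.
Qed.

Lemma square_pairsM m n : 0 < m -> 0 < n -> coprime m n ->
  square_pairs (m * n) = square_pairs m * square_pairs n.
Proof.
move=> m0 n0 co.
pose G d u v := [&& unit_square d u, unit_square d v & unit_square d (u + v)].
have GE d u v : G d (u %% d) (v %% d) = G d u v.
  by rewrite /G unit_square_modD !unit_square_mod.
transitivity (\sum_(u < m * n) \sum_(v < m * n)
   G m (u %% m) (v %% m) * G n (u %% n) (v %% n)).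
  apply: eq_bigr => u _; apply: eq_bigr => v _.
  rewrite !GE mulnb /G !unit_squareM //; congr nat_of_bool.
  by do 6 case: (unit_square _ _).
under eq_bigr => u _ do
  rewrite (sum_ord_chinese (fun v w => G m (u %% m) v * G n (u %% n) w)) //.
rewrite (sum_ord_chinese
  (fun s t => \sum_(v < m) \sum_(w < n) G m s v * G n t w)) //.
rewrite big_distrl /=; apply: eq_bigr => s _; rewrite big_distrr /=.
apply: eq_bigr => t _; rewrite big_distrlr //=.
Qed.

(** By Hensel lifting the condition depends only on [u] and [v] modulo [p], and each residue modulo
    [p] has [p ^ e] lifts in each coordinate. *)
Lemma square_pairs_pfactor p e : prime p -> odd p ->
  square_pairs (p ^ e.+1) = p ^ (2 * e) * square_pairs p.
Proof.
move=> pp op.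
pose G u v := [&& unit_square p u, unit_square p v & unit_square p (u + v)].
transitivity (\sum_(u < p ^ e * p) \sum_(v < p ^ e * p) G (u %% p) (v %% p)).
  rewrite /square_pairs -expnSr; apply: eq_bigr => u _; apply: eq_bigr => v _.
  by rewrite !unit_square_pfactor // /G unit_square_modD !unit_square_mod.
under eq_bigr => u _ do rewrite (sum_ord_modn _ _ (fun v => G (u %% p) v)).
rewrite (sum_ord_modn _ _ (fun u => _ * \sum_(v < p) G u v)).
by rewrite -big_distrr mulnA -expnD addnn -mul2n.
Qed.

Lemma square_pairs1 : square_pairs 1 = 1.
Proof.
have us x : unit_square 1 x.
  apply/unit_squareP => //.
  by split; [apply: coprime1n | exists 0; rewrite !modn1].
by rewrite /square_pairs !big_ord_recl !big_ord0 /= !us.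
Qed.

Lemma coprime_prod_pfactors (I : eqType) (p alpha : I -> nat) (i : I)
    (s : seq I) :
  (forall i, prime (p i)) -> injective p -> i \notin s ->
  coprime (p i ^ alpha i) (\prod_(j <- s) p j ^ alpha j).
Proof.
move=> pp pI; elim: s => [|j s IHs]; first by rewrite big_nil coprimen1.
rewrite inE negb_or big_cons coprimeMr => /andP[ij /IHs->]; rewrite andbT.
by rewrite coprimeXl ?coprimeXr // prime_coprime // dvdn_prime2 // (inj_eq pI).
Qed.

Lemma square_pairs_prod (I : eqType) (p alpha : I -> nat) (s : seq I) :
  (forall i, prime (p i)) -> injective p -> uniq s ->
  square_pairs (\prod_(i <- s) p i ^ alpha i)
    = \prod_(i <- s) square_pairs (p i ^ alpha i).
Proof.
move=> pp pI; elim: s => [|i s IHs] /=; first by rewrite !big_nil square_pairs1.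
case/andP=> is_ us; rewrite !big_cons square_pairsM ?IHs //.
- by rewrite expn_gt0 prime_gt0.
- by rewrite prodn_gt0 // => j; rewrite expn_gt0 prime_gt0.
exact: coprime_prod_pfactors.
Qed.

Lemma unit_square_prod (I : eqType) (p alpha : I -> nat) (s : seq I) x :
  (forall i, prime (p i)) -> injective p -> uniq s ->
  unit_square (\prod_(i <- s) p i ^ alpha i) x
    = all (fun i => unit_square (p i ^ alpha i) x) s.
Proof.
move=> pp pI; elim: s => [|i s IHs] /=.
  rewrite big_nil => _; apply/unit_squareP => //.
  by split; [apply: coprime1n | exists 0; rewrite !modn1].
case/andP=> is_ us; rewrite !big_cons unit_squareM ?IHs //.
- by rewrite expn_gt0 prime_gt0.
- by rewrite prodn_gt0 // => j; rewrite expn_gt0 prime_gt0.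
exact: coprime_prod_pfactors.
Qed.

(** * Ordered cliques and triangles of Cayley graphs *)

(** Group the tuples by their underlying set: each fibre consists of the [m]! orderings of one
    clique. *)
Lemma ordered_cliques (m : nat) (T : finType) (e : rel T) :
  #|[set t : m.-tuple T | uniq t & clique e [set x in t]]|
    = num_cliques m e * m`!.
Proof.
rewrite -sum1_card /num_cliques.
rewrite (partition_big (fun t : m.-tuple T => [set x in t])
  (mem [set S : {set T} | (#|S| == m) && clique e S])) /=; last first.
  move=> t; rewrite !inE => /andP[ut ->]; rewrite andbT cardsE.
  by rewrite (card_uniqP ut) size_tuple.
rewrite -sum_nat_const; apply: eq_bigr => S; rewrite inE => /andP[/eqP cS clS].
rewrite sum1_card -ffactnn.
transitivity (#|S| ^_ m); last by rewrite cS.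
rewrite -(card_uniq_tuples m (mem S)); apply: eq_card => t.
rewrite unfold_in !inE; apply/idP/idP.
  case/andP=> /andP[-> _] /eqP <-; rewrite andbT.
  by apply/allP=> x; rewrite /= inE.
case/andP=> /allP tS ut; suff -> : [set x in t] = S by rewrite ut clS eqxx.
apply/eqP; rewrite eqEcard cS cardsE (card_uniqP ut) size_tuple leqnn andbT.
by apply/subsetP => x; rewrite inE => /tS.
Qed.

Local Open Scope ring_scope.

(** The connection set that makes the Paley-type graph a Cayley graph of the additive group. *)
Definition unit_squares (R : finUnitRingType) : pred R :=
  fun x => [exists a : R, (a \is a GRing.unit) && (x == a ^+ 2)].

Lemma clique3E (T : finType) (e : rel T) (x y z : T) : symmetric e ->
  irreflexive e ->
  (uniq [:: x; y; z] && clique e [set u in [:: x; y; z]])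
    = [&& e x y, e y z & e x z].
Proof.
move=> sym irr; apply/idP/idP.
  case/andP=> /=; rewrite !inE negb_or => /andP[/andP[xy xz] /andP[yz _]].
  move=> /forall_inP cl.
  have cl2 u v : u \in [:: x; y; z] -> v \in [:: x; y; z] -> u != v -> e u v.
    move=> us vs; move/(_ u): cl; rewrite inE => /(_ us)/forall_inP/(_ v).
    by rewrite inE => /(_ vs)/implyP.
  by rewrite !cl2 // !inE eqxx ?orbT.
case/and3P=> xy yz xz.
have ne u v : e u v -> u != v by apply: contraTneq => ->; rewrite irr.
rewrite /= !inE negb_or !ne //=; apply/forall_inP => u; rewrite !inE => us.
apply/forall_inP => v; rewrite !inE => vs; apply/implyP.
by case/or3P: us => /eqP->; case/or3P: vs => /eqP->; rewrite ?eqxx // sym.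
Qed.

Section Cayley.
Variables (V : finZmodType) (S : pred V).
Hypotheses (SN : forall x, S (- x) = S x) (S0 : S 0 = false).

Lemma cayley_triangles :
  (num_cliques 3 (fun x y : V => S (x - y)%R) * 6
   = #|V| * #|[set w : V * V | [&& S w.1, S w.2 & S (w.1 + w.2)%R]]|)%N.
Proof.
rewrite -[6%N]/(3`!) -ordered_cliques -cardsT -cardsX.
(* The consecutive differences of this triple are [u] and [v], and its outer difference is
   [u + v]. *)
pose f (w : V * (V * V)) := [tuple w.1 + w.2.2 + w.2.1; w.1 + w.2.2; w.1].
have f_inj : injective f.
  move=> [x [u v]] [x' [u' v']] /(congr1 val) /= [].
  move=> e1 e2 e3; subst x'; move/addrI: e2 => e2; subst v'.
  by move/addrI: e1 => ->.
rewrite -(card_imset _ f_inj); apply: eq_card => t; rewrite !inE.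
have sym : symmetric (fun x y : V => S (x - y)).
  by move=> x y; rewrite -opprB SN.
have irr : irreflexive (fun x y : V => S (x - y)) by move=> x; rewrite subrr S0.
case: t => -[|x [|y [|z []]]] //= t3.
rewrite (clique3E x y z sym irr); apply/idP/imsetP.
  case/and3P=> xy yz xz; exists (z, (x - y, y - z)).
    by rewrite !inE /= xy yz addrA subrK.
  by apply/val_inj; rewrite /= [z + _]addrC subrK [y + _]addrC subrK.
case=> -[z' [u v]]; rewrite !inE /= => /and3P[Su Sv Suv].
move=> /(congr1 val) /= [-> -> ->].
by rewrite ![_ + u]addrC addrK ![_ + v]addrC addrA !addrK Su Sv Suv.
Qed.
End Cayley.

(** * Pythagorean triples and square roots in a finite field *)

Section FiniteField.
Variables (F : finFieldType) (i : F).
Hypotheses (i2 : i ^+ 2 = -1) (F2 : 2%:R != 0 :> F).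

Local Notation Sq := (@unit_squares F).

Lemma card_pythagorean :
  (#|[set w : F * F * F | [&& w.1.1 != 0%R, w.1.2 != 0%R, w.2 != 0%R
     & (w.1.1 ^+ 2 + w.1.2 ^+ 2 == w.2 ^+ 2)%R]]| = (#|F| - 1) * (#|F| - 5))%N.
Proof.
have n11 : 1 != -1 :> F by rewrite -subr_eq0 opprK.
have i0 : i != 0.
  by apply: contra_eq_neq i2 => ->; rewrite expr0n eq_sym oppr_eq0 oner_eq0.
have i1 : i != 1 by apply: contraNneq n11 => E; rewrite -i2 E expr1n.
have iN1 : i != -1 by apply: contraNneq n11 => E; rewrite -i2 E sqrrN expr1n.
(* Solving [r = (c - a) / b] and [r^-1 = (c + a) / b] for [a] and [c] gives this inverse of the
   parametrisation. *)
pose f (w : F * F) : F * F * F :=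
  (w.1 * (w.2^-1 - w.2) / 2, w.1, w.1 * (w.2^-1 + w.2) / 2).
pose B := setX [set~ (0 : F)] (~: [set x in [:: 0; 1; -1; i; -i]]).
have BE b r : ((b, r) \in B) = [&& b != 0, r != 0, r ^+ 2 != 1 & r ^+ 2 != -1].
  rewrite !inE /= !negb_or sqrf_eq1 -i2 eqf_sqr i2 !negb_or.
  by rewrite -!andbA.
(* The five excluded values of [r] are distinct, because [2] and [i] are nonzero and [i] is neither
   [1] nor [-1]. *)
have ->: ((#|F| - 1) * (#|F| - 5) = #|B|)%N.
  rewrite cardsX cardsCs setCK cards1 cardsCs setCK cardsE.
  rewrite (card_uniqP _) //= !inE !negb_or !(eq_sym 0) oppr_eq0 oner_eq0 i0.
  rewrite oppr_eq0 i0 n11 !(eq_sym _ i) i1 iN1 !(eq_sym _ (- i)) eqr_oppLR iN1.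
  by rewrite eqr_opp i1 -subr_eq0 -opprD oppr_eq0 -mulr2n -mulr_natr mulf_neq0.
have f_inj : {in B &, injective f}.
  move=> [b r] [b' r']; rewrite !BE /= => /and4P[b0 r0 _ _] _ [].
  move=> e1 e2 e3; subst b'; congr (_, _).
  (* The difference [c - a] recovers [b * r], hence [r]. *)
  have K (t s : F) : b * (t + s) / 2 - b * (t - s) / 2 = b * s by field.
  by apply: (mulfI b0); rewrite -(K r^-1 r) -(K r'^-1 r') e1 e3.
rewrite -(card_in_imset f_inj); apply: eq_card => -[[a b] c].
rewrite !inE /=; apply/idP/imsetP.
  case/and4P=> a0 b0 c0 /eqP abc.
  have rr : ((c - a) / b) * ((c + a) / b) = 1.
    rewrite mulrACA -subr_sqr -abc [_ ^+ 2 + _]addrC addrK -invfM.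
    by rewrite divff // mulf_neq0.
  have r0 : (c - a) / b != 0.
    by apply: contraNneq (oner_neq0 F) => E; rewrite -rr E mul0r.
  have rV : ((c - a) / b)^-1 = (c + a) / b.
    by apply: (mulfI r0); rewrite rr divff.
  exists (b, (c - a) / b); last first.
    by rewrite /f /= rV; congr (_, _, _); field; rewrite ?F2 ?b0.
  (* Writing [1] as [r * r^-1] and cancelling [r] and [b] turns the two conditions into
     [c - a != c + a] and [c - a != - c - a], that is, [a] and [c] nonzero. *)
  rewrite BE b0 r0 expr2 /= -rr -mulrN !(inj_eq (mulfI r0)).
  rewrite -mulNr !(inj_eq (divIf b0)) opprD; apply/andP; split.
    rewrite (inj_eq (addrI c)) eq_sym.
    by rewrite -subr_eq0 opprK -mulr2n -mulr_natr mulf_neq0.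
  rewrite (inj_eq (addIr (- a))).
  by rewrite -subr_eq0 opprK -mulr2n -mulr_natr mulf_neq0.
case=> -[b' r]; rewrite BE /= => /and4P[b0 r0 r1 rN1] [-> -> ->].
have -> : r^-1 - r = (1 - r ^+ 2) / r by field.
have -> : r^-1 + r = (1 + r ^+ 2) / r by field.
apply/and4P; split=> //; rewrite ?mulf_neq0 ?invr_eq0 //.
- by rewrite subr_eq0 eq_sym.
- by rewrite addrC addr_eq0.
by apply/eqP; field; rewrite ?F2.
Qed.

Lemma card_unit_square_roots x : Sq x ->
  #|[set a : F | (a != 0) && (a ^+ 2 == x)]| = 2%N.
Proof.
case/existsP=> a /andP[]; rewrite unitfE => a0 /eqP ->.
have ->: [set b : F | (b != 0) && (b ^+ 2 == a ^+ 2)] = [set a; - a].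
  apply/setP=> b; rewrite !inE eqf_sqr; apply: andb_idl.
  by case/orP=> /eqP->; rewrite ?oppr_eq0.
by rewrite cards2 -subr_eq0 opprK -mulr2n -mulr_natr mulf_neq0.
Qed.

(** Squaring maps Pythagorean triples onto these pairs; each of [u], [v] and [u + v] has two roots,
    so every fibre has 8 elements. *)
Lemma card_square_pairs :
  (#|[set w : F * F | [&& Sq w.1, Sq w.2 & Sq (w.1 + w.2)%R]]| * 8
   = (#|F| - 1) * (#|F| - 5))%N.
Proof.
rewrite -card_pythagorean -[RHS]sum1_card.
pose Q := [set w : F * F | [&& Sq w.1, Sq w.2 & Sq (w.1 + w.2)%R]].
rewrite (partition_big
  (fun w => (w.1.1 ^+ 2, w.1.2 ^+ 2)) (mem Q)) /=; last first.
  move=> [[a b] c]; rewrite !inE /= => /and4P[a0 b0 c0 /eqP->].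
  by apply/and3P; split; apply/existsP;
    [exists a | exists b | exists c]; rewrite unitfE ?a0 ?b0 ?c0 eqxx.
rewrite -sum_nat_const; apply: eq_bigr => -[u v]; rewrite inE /=.
case/and3P=> Su Sv Suv.
pose R x := [set a : F | (a != 0) && (a ^+ 2 == x)].
rewrite sum1_card; transitivity #|setX (setX (R u) (R v)) (R (u + v))|.
  by rewrite !cardsX !card_unit_square_roots.
apply: eq_card => -[[a b] c]; rewrite [RHS]unfold_in !inE /= xpair_eqE.
apply/idP/idP.
  case/andP=> /andP[/andP[-> /eqP->] /andP[-> /eqP->]] /andP[-> /eqP->].
  by rewrite !eqxx.
case/andP=> /and4P[-> -> -> /eqP <-] /andP[/eqP <- /eqP <-].
by rewrite !eqxx.
Qed.

End FiniteField.

(** With [#|F| = 4 * m + 1], the polynomial ['X^(2 * m) - 1] has too few roots to vanish at every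
    nonzero element. A nonzero [x] that is not a root has [x ^+ (4 * m) = 1], so [x ^+ (2 * m) = -1]
    and [x ^+ m] is a square root of [-1]. As this power differs from [1], the characteristic is not
    2. *)
Lemma finField_sqrtN1 (F : finFieldType) : #|F| = 1 %[mod 4] ->
  2%:R != 0 :> F /\ exists i : F, i ^+ 2 = -1.
Proof.
move=> F1; pose m := (#|F| %/ 4)%N.
have cardF : #|F| = (4 * m).+1 by rewrite [LHS](divn_eq _ 4) F1 mulnC addn1.
have m0 : (0 < m)%N.
  by rewrite lt0n; apply: contraTneq (finRing_gt1 F) => E; rewrite cardF E.
have [x /andP[x0 x1]] : exists x : F, (x != 0) && (x ^+ (2 * m) != 1).
  apply/existsP; apply: contraT; rewrite negb_exists => /forallP all1.
  pose rs := enum [set~ (0 : F)].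
  have := @max_poly_roots F ('X^(2 * m) - 1) rs.
  rewrite -size_poly_eq0 size_XnsubC ?muln_gt0 // => /(_ isT).
  rewrite enum_uniq -cardE cardsC1 cardF.
  have -> : all (root ('X^(2 * m) - 1)) rs.
    apply/allP=> x; rewrite mem_enum !inE => x0; have := all1 x.
    by rewrite x0 negbK rootE !hornerE subr_eq0.
  by move/(_ isT isT); lia.
have xN1 : x ^+ (2 * m) = -1.
  apply/eqP; have: (x ^+ (2 * m)) ^+ 2 == 1.
    rewrite -exprM; apply/eqP/(mulIf x0).
    by rewrite mul1r -exprSr -[RHS]expf_card cardF; congr (x ^+ _.+1); lia.
  by rewrite sqrf_eq1 (negPf x1).
split; last by exists (x ^+ m); rewrite -exprM mulnC.
by rewrite -[2%:R]/(1 + 1) addr_eq0 -xN1 eq_sym.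
Qed.

(** * Transfer between natural numbers and the rings ['Z_n] and ['F_p] *)

Lemma eqr_Zp_nat n x y : (1 < n)%N ->
  (x%:R == y%:R :> 'Z_n) = (x == y %[mod n])%N.
Proof. by move=> n1; rewrite -val_eqE /= !val_Zp_nat. Qed.

Lemma unit_squaresE n (x : nat) : (1 < n)%N ->
  unit_squares (x%:R : 'Z_n) = unit_square n x.
Proof.
move=> n1; have n0 := ltnW n1.
apply/existsP/unit_squareP => //.
  case=> a; rewrite -[a]natr_Zp -natrX eqr_Zp_nat // unitZpE //.
  case/andP=> co /eqP xa; split; last by exists (val a).
  by rewrite -coprime_modr xa coprime_modr coprimeXr.
case=> cox [a ax]; exists a%:R; rewrite unitZpE // -natrX eqr_Zp_nat // ax.
rewrite eqxx andbT -(coprime_pexpr _ _ (isT : 0 < 2)%N).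
by rewrite -coprime_modr ax coprime_modr.
Qed.

Lemma square_pairsE n : (1 < n)%N ->
  square_pairs n = #|[set w : 'Z_n * 'Z_n | [&& unit_squares w.1,
    unit_squares w.2 & unit_squares (w.1 + w.2)%R]]|.
Proof.
(* Once the modulus has the form [n.+2], ['Z_n.+2] is convertible to ['I_n.+2]. *)
case: n => [|[|n]] // n1; rewrite -sum1_card /square_pairs pair_big /=.
rewrite [RHS]big_mkcond; apply: eq_bigr => -[u v] _; rewrite inE /=.
rewrite -!(unit_squaresE _ n1) natrD !natr_Zp.
by case: ifP.
Qed.

Lemma square_pairs_prime p : prime p -> p = 1 %[mod 4] ->
  (square_pairs p * 8 = (p - 1) * (p - 5))%N.
Proof.
move=> pp p4; have cF := card_Fp pp.
have [|F2 [i i2]] := @finField_sqrtN1 'F_p; first by rewrite cF.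
(* ['F_p] is ['Z_(pdiv p)], hence the detour through [pdiv p]. *)
rewrite -{2 3}cF -(card_square_pairs i2 F2) -{1}(pdiv_id pp) square_pairsE //.
by rewrite pdiv_id // prime_gt1.
Qed.

(** [m.-1] represents [-1] modulo every divisor of [m]; keeping [m] apart from [p] lets one number
    serve all prime factors of [n]. *)
Lemma unit_squareN1 p m : prime p -> p = 1 %[mod 4] ->
  (0 < m)%N -> (p %| m)%N ->
  unit_square p m.-1.
Proof.
move=> pp p4 m0 pm.
have [|F2 [i i2]] := @finField_sqrtN1 'F_p; first by rewrite card_Fp.
rewrite -{1}(pdiv_id pp) -unit_squaresE; last by rewrite pdiv_id // prime_gt1.
have -> : m.-1%:R = -1 :> 'F_p.
  by apply/eqP; rewrite -addr_eq0 natr1 prednK // -(dvdn_pcharf (pchar_Fp pp)).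
apply/existsP; exists i; rewrite i2 eqxx andbT unitfE.
by apply: contra_eq_neq i2 => ->; rewrite expr0n eq_sym oppr_eq0 oner_eq0.
Qed.

(** If [-1] is the square of the unit [i], then [a ^+ 2] has opposite [(i * a) ^+ 2]. This makes the
    graph symmetric. *)
Lemma unit_squaresN n : (1 < n)%N -> unit_square n n.-1 ->
  forall x : 'Z_n, unit_squares (- x) = unit_squares x.
Proof.
move=> n1; rewrite -unit_squaresE // => /existsP[i /andP[iU /eqP i2]].
have nN1 : n.-1%:R = -1 :> 'Z_n.
  apply/eqP; rewrite -addr_eq0 natr1 prednK ?(ltnW n1) //.
  by rewrite -[0]/(0%:R) eqr_Zp_nat // modnn mod0n.
have sub (x : 'Z_n) : unit_squares x -> unit_squares (- x).
  case/existsP=> a /andP[aU /eqP ->]; apply/existsP; exists (i * a).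
  by rewrite unitrM iU aU exprMn -i2 nN1 mulN1r eqxx.
by move=> x; apply/idP/idP => [/sub|/sub //]; rewrite opprK.
Qed.

Lemma unit_squares0 n : unit_squares (0 : 'Z_n) = false.
Proof.
apply/existsP => -[a /andP[aU /eqP/esym a0]].
by have := unitrX 2 aU; rewrite a0 unitr0.
Qed.

(** * Assembly over the prime factors *)

Theorem theorem1p1 (k : nat) (p alpha : 'I_k -> nat) (n : nat)
    (hk : (1 <= k)%N)
    (halpha : forall i, (1 <= alpha i)%N)
    (p_prime : forall i, prime (p i))
    (p_inj : injective p)
    (p_mod4 : forall i, p i = 1 %[mod 4])
    (hn : n = (\prod_(i < k) p i ^ alpha i)%N) :
  (num_cliques 3 (@paley_graph n))%:R =
    1 / (3 * 2 ^+ (3 * k + 1)) *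
    \prod_(i < k) ((p i)%:R ^+ (3 * alpha i - 2)
                   * ((p i)%:R - 1) * ((p i)%:R - 5)) :> rat.
Proof.
have p_mod1 i : (p i %% 4 = 1)%N by rewrite p_mod4.
(* This bound keeps the natural subtraction [p i - 5] from truncating when it is cast to [rat]. *)
have p_ge5 i : (5 <= p i)%N.
  have := prime_gt1 (p_prime i); have := p_mod1 i.
  by move: (p i) => [|[|[|[|[|q]]]]].
have p_odd i : odd (p i).
  by rewrite -(odd_mod (p i) (erefl : odd 4 = false)) p_mod1.
have dvd_n i : (p i %| n)%N.
  rewrite hn (bigD1 i) //= dvdn_mulr // -(subnK (halpha i)) addn1.
  by rewrite expnS dvdn_mulr.
have n0 : (0 < n)%N by rewrite hn prodn_gt0 // => i; rewrite expn_gt0 prime_gt0.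
have n1 : (1 < n)%N.
  by apply: leq_trans (dvdn_leq n0 (dvd_n (Ordinal hk))); apply: prime_gt1.
have sqN1 : unit_square n n.-1.
  rewrite {1}hn unit_square_prod ?index_enum_uniq //; apply/allP => i _.
  rewrite -(subnK (halpha i)) addn1 unit_square_pfactor //.
  exact: unit_squareN1.
have sq_p i : (square_pairs (p i ^ alpha i) * 8
    = p i ^ (2 * (alpha i).-1) * ((p i - 1) * (p i - 5)))%N.
  rewrite -{1}(prednK (halpha i)) square_pairs_pfactor // -mulnA.
  by rewrite square_pairs_prime.
have := cayley_triangles (unit_squaresN n1 sqN1) (@unit_squares0 n).
rewrite -[X in (num_cliques 3 X * 6)%N]/(@paley_graph n) -square_pairsE //.
have -> : #|'Z_n| = n by rewrite card_ord Zp_cast.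
have -> : (n * square_pairs n
    = \prod_(i < k) (p i ^ alpha i * square_pairs (p i ^ alpha i)))%N.
  by rewrite big_split /= hn square_pairs_prod ?index_enum_uniq.
move=> /(congr1 (fun m => m%:R : rat)).
rewrite natrM natr_prod => K6.
apply: (@mulIf _ (6%:R : rat)) => //; rewrite K6.
under [in RHS]eq_bigr => i _.
  (* The exponents add up as [alpha + 2 * (alpha - 1) = 3 * alpha - 2], with no truncation since
     [alpha] is positive. The factors 8 multiply to [8 ^ k], which cancels against
     [6 / (3 * 2 ^ (3 * k + 1))]. *)
  have -> : (p i)%:R ^+ (3 * alpha i - 2) * ((p i)%:R - 1) * ((p i)%:R - 5)
     = (p i ^ alpha i * square_pairs (p i ^ alpha i))%:R * 8 :> rat.
    rewrite -natrM -mulnA sq_p !natrM !natrB ?natrX //; last first.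
    - exact: leq_trans (p_ge5 i).
    have a0 := halpha i.
    rewrite !mulrA -exprD.
    by congr (_ ^+ _ * _ * _); lia.
  over.
rewrite big_split /= prodr_const card_ord.
move: (\prod_(i < k) _) => P.
rewrite addn1 exprS exprM.
have : (2 ^+ 3) ^+ k != 0 :> rat by rewrite expf_neq0.
rewrite -[2 ^+ 3]/(8%:R : rat); move: (8%:R ^+ k) => E E0.
by field.
Qed.
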